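(* Let $G$ be an amenable unimodular locally compact group with Haar measure $\theta$, and let $f\colon \mathcal{K}(G)\to \mathbb{R}$ be a monotone, subadditive and right-invariant function. Then for every van Hove net $(A_i)_{i\in I}$ in $G$ the limit $$\lim_{i\in I}\frac{f(A_i)}{\theta(A_i)}$$ exists, is finite, and is independent of the choice of the van Hove net.
   Context: Topological groups are assumed Hausdorff. $\mathcal{K}(G)$ denotes the set of all compact subsets of $G$. A function $f\colon\mathcal{K}(G)\to\mathbb{R}$ is monotone if $f(E)\leq f(F)$ whenever $E\subseteq F$; subadditive if $f(\emptyset)=0$ and $f(E\cup F)\leq f(E)+f(F)$ for all $E,F$; right-invariant if $f(Ag)=f(A)$ for all $A\in\mathcal{K}(G)$, $g\in G$. For $K,A\subseteq G$ put $\partial_K A=K\overline{A}\cap K\overline{G\setminus A}$. A net $(A_i)_{i\in I}$ of compact subsets of $G$ is called van Hove if $\lim_{i\in I}\theta(\partial_K A_i)/\theta(A_i)=0$ for every compact $K\subseteq G$ (it is implicitly assumed that $\theta(A_i)>0$ for all sufficiently large $i$). *)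

(* Defs.v *)
From HB Require Import structures.
From mathcomp Require Import all_boot all_order all_algebra.
From mathcomp Require Import all_classical all_reals all_analysis.

Set Implicit Arguments.
Unset Strict Implicit.
Unset Printing Implicit Defensive.
Import Order.TTheory GRing.Theory Num.Theory.
Import numFieldNormedType.Exports.

Local Open Scope classical_set_scope.
Local Open Scope ring_scope.

HB.mixin Record isTopologicalGroup G & Topological G & Group G := {
  mulg_continuous : continuous (fun x : G * G => (x.1 * x.2)%g) ;
  invg_continuous : continuous (fun x : G => (x^-1)%g)
}.

(* Pointed is required by g_sigma_algebraType; the base point is arbitrary and
   plays no role. Separation and local compactness are separate hypotheses. *)
#[short(type="topologicalGroupType")]
HB.structure Definition TopologicalGroup :=
  {G of PointedTopological G & Group G & isTopologicalGroup G}.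

Section set_operations.
Context {G : topologicalGroupType}.
Implicit Types (A B K : set G) (g : G).

Definition mulset A B : set G := [set (a * b)%g | a in A & b in B].

Definition ltranslate g A : set G := [set (g * a)%g | a in A].

Definition rtranslate A g : set G := [set (a * g)%g | a in A].

Definition boundary K A : set G :=
  mulset K (closure A) `&` mulset K (closure (~` A)).

End set_operations.

Notation borelType G := (g_sigma_algebraType (@open G)).

Section haar_measure.
Context {R : realType} {G : topologicalGroupType}.
Implicit Types mu : {measure set (borelType G) -> \bar R}.

Definition radon mu : Prop :=
  [/\ forall K : set G, compact K -> (mu K < +oo)%E,
      forall B : set (borelType G), measurable B ->
        mu B = ereal_inf [set mu U | U in [set U : set G | open U /\ B `<=` U]]
    & forall U : set G, open U ->
        mu U = ereal_sup
                 [set mu K | K in [set K : set G | compact K /\ K `<=` U]]].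

Definition left_invariant mu : Prop :=
  forall (g : G) (B : set (borelType G)), measurable B ->
    mu (ltranslate g B) = mu B.

Definition right_invariant mu : Prop :=
  forall (g : G) (B : set (borelType G)), measurable B ->
    mu (rtranslate B g) = mu B.

Definition haar mu : Prop :=
  [/\ radon mu, left_invariant mu & mu [set: G] != 0%E].

End haar_measure.

(* By uniqueness of Haar measure up to scaling, quantifying over all left Haar
   measures or over some left Haar measure is the same. *)
Definition unimodular (R : realType) (G : topologicalGroupType) : Prop :=
  forall mu : {measure set (borelType G) -> \bar R}, haar mu ->
    right_invariant mu.

Section amenability.
Context {R : realType} {G : topologicalGroupType}.
Implicit Types phi psi : G -> R.

(* phi is bounded and uniformly continuous for the right uniformity, whose
   entourages are the sets {(x, y) | y x^-1 in U}, U a neighbourhood of 1. *)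
Definition rucb phi : Prop :=
  (exists M : R, forall x, `|phi x| <= M) /\
  (forall e : R, 0 < e ->
    \forall u \near (1%g : G), forall x, `|phi (u * x)%g - phi x| < e).

(* Only the values of m on rucb functions matter. *)
Definition left_invariant_mean (m : (G -> R) -> R) : Prop :=
  [/\ forall (a : R) phi psi, rucb phi -> rucb psi ->
        m (fun x => a * phi x + psi x) = a * m phi + m psi,
      forall phi, rucb phi -> (forall x, 0 <= phi x) -> 0 <= m phi,
      m (fun=> 1) = 1
    & forall (g : G) phi, rucb phi -> m (fun x => phi (g * x)%g) = m phi].

End amenability.

Definition amenable (R : realType) (G : topologicalGroupType) : Prop :=
  exists m : (G -> R) -> R, left_invariant_mean m.

(* A function on the compact subsets of G is represented by a function on all
   subsets whose values on non-compact subsets are never used. *)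
Section compact_set_functions.
Context {R : realType} {G : topologicalGroupType}.
Implicit Types f : set G -> R.

Definition compact_monotone f : Prop :=
  forall E F : set G, compact E -> compact F -> E `<=` F -> f E <= f F.

Definition compact_subadditive f : Prop :=
  f set0 = 0 /\
  forall E F : set G, compact E -> compact F -> f (E `|` F) <= f E + f F.

Definition compact_right_invariant f : Prop :=
  forall (A : set G) (g : G), compact A -> f (rtranslate A g) = f A.

End compact_set_functions.

Section nets.
Context {I : Type}.
Implicit Types le : I -> I -> Prop.

Definition directed le : Prop :=
  [/\ inhabited I,
      forall i, le i i,
      forall i j k, le i j -> le j k -> le i k
    & forall i j, exists k, le i k /\ le j k].

(* The limit of a net is the limit along the filter generated by its tails. *)
Definition tails le : set_system I :=
  filter_from setT (fun i => [set j | le i j]).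

End nets.

(* The measures involved are finite: A_i and the boundary of A_i are compact. *)
Definition van_hove {R : realType} {G : topologicalGroupType}
    (theta : {measure set (borelType G) -> \bar R})
    {I : Type} (le : I -> I -> Prop) (A : I -> set G) : Prop :=
  [/\ forall i, compact (A i),
      \forall i \near tails le, (0 < theta (A i))%E
    & forall K : set G, compact K ->
        fine (theta (boundary K (A i))) / fine (theta (A i))
          @[i --> tails le] --> (0 : R)].

(* Main.v *)
Require Import Defs.
From HB Require Import structures.
From mathcomp Require Import all_boot all_order all_algebra.
From mathcomp Require Import all_classical all_reals all_analysis.
From mathcomp Require Import measurable_realfun ring lra.

(* Call t >= 0 an asymptotic bound if, for some compact K and some C,
   f B <= t * theta B + C * theta (boundary K B) for every compact B. Every
   asymptotic bound is an upper bound for the upper limit of f / theta along a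
   van Hove net, so it suffices to compare the lower limit with the infimum M
   of the asymptotic bounds. Suppose that there are arbitrarily invariant
   compact sets F with f F <= L * theta F, where L < M. A maximal family of
   almost disjoint right translates of such an F inside B covers, up to a
   boundary term, a fixed proportion of B (an averaging argument, which uses
   theta (F^-1) <= theta F), and the boundary of the uncovered part is
   controlled by those of B and F. Bounding f by L on the covered part and by
   an asymptotic bound t close to M on the rest gives an asymptotic bound
   smaller than M, a contradiction. Only this one step of the Ornstein-Weiss
   quasi-tiling is needed. *)

Set Implicit Arguments.
Unset Strict Implicit.
Unset Printing Implicit Defensive.
Import Order.TTheory GRing.Theory Num.Theory.
Import numFieldNormedType.Exports.
Local Open Scope classical_set_scope.
Local Open Scope ring_scope.

(** * Translates, products and boundaries of sets in a topological group *)

Section topology.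
Context {G : topologicalGroupType}.
Implicit Types (A B C F K O : set G) (c g x y : G) (s : seq G).

Lemma continuous_mulgr g : continuous (fun x : G => (x * g)%g).
Proof.
move=> x.
apply: (@cvg_comp _ _ _ (fun x : G => (x, g)) (fun p => (p.1 * p.2)%g) _
  (nbhs (x, g))).
  by apply: cvg_pair => /=; [exact: cvg_id | exact: cvg_cst].
exact: (@mulg_continuous G (x, g)).
Qed.

Lemma continuous_mulgl g : continuous (fun x : G => (g * x)%g).
Proof.
move=> x.
apply: (@cvg_comp _ _ _ (fun x : G => (g, x)) (fun p => (p.1 * p.2)%g) _
  (nbhs (g, x))).
  by apply: cvg_pair => /=; [exact: cvg_cst | exact: cvg_id].
exact: (@mulg_continuous G (g, x)).
Qed.

Lemma continuous_divg : continuous (fun p : G * G => (p.1 / p.2)%g).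
Proof.
move=> p; apply: (@cvg_comp _ _ _ (fun p : G * G => (p.1, p.2^-1)%g)
  (fun p => (p.1 * p.2)%g) _ (nbhs (p.1, p.2^-1)%g)); last first.
  exact: (@mulg_continuous G (p.1, p.2^-1)%g).
apply: cvg_pair => /=; first exact: cvg_fst.
apply: (@cvg_comp _ _ _ snd (fun x => x^-1)%g _ (nbhs p.2)); first exact: cvg_snd.
exact: invg_continuous.
Qed.

Lemma mem_rtranslate A g x : rtranslate A g x <-> A (x * g^-1)%g.
Proof.
split=> [[a Aa <-]|Ax]; first by rewrite mulgK.
by exists (x * g^-1)%g => //; rewrite mulgVK.
Qed.

Lemma compact_rtranslate A g : compact A -> compact (rtranslate A g).
Proof.
by apply: continuous_compact; apply: continuous_subspaceT; exact: continuous_mulgr.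
Qed.

Lemma open_rtranslate O g : open O -> open (rtranslate O g).
Proof.
move=> Oo; rewrite (_ : rtranslate O g = (fun x => x * g^-1)%g @^-1` O).
  by apply: open_comp => // x _; exact: continuous_mulgr.
by apply/seteqP; split => x /mem_rtranslate.
Qed.

Lemma compact_inv A : compact A -> compact [set (a^-1)%g | a in A].
Proof.
by apply: continuous_compact; apply: continuous_subspaceT; exact: invg_continuous.
Qed.

Lemma compact_mulset A B : compact A -> compact B -> compact (mulset A B).
Proof.
move=> cA cB.
rewrite (_ : mulset A B = (fun p : G * G => (p.1 * p.2)%g) @` (A `*` B)).
  apply: continuous_compact; last exact: compact_setX.
  by apply: continuous_subspaceT; exact: mulg_continuous.
apply/seteqP; split => [x [a Aa [b Bb <-]]|x [[a b] [/= Aa Bb] <-]].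
  by exists (a, b).
by exists a => //; exists b.
Qed.

(** A form of the tube lemma: compactness of [K] lets one neighbourhood of [t] serve all [k] at
    once. *)
Lemma near_compact_sub (T : topologicalType) (h : T * G -> G) K O (t : T) :
  continuous h -> compact K -> open O -> (forall k, K k -> O (h (t, k))) ->
  \forall u \near t, forall k, K k -> O (h (u, k)).
Proof.
move=> hc cK oO KO.
have /compact_near_coveringP/(_ T (nbhs t) (fun u k => O (h (u, k)))) := cK.
apply => k Kk.
have /hc : nbhs (h (t, k)) O by apply: open_nbhs_nbhs; split => //; exact: KO.
rewrite /= => -[[P Q] /= [Pn Qn] PQ].
by exists (Q, P) => // -[a b] [/= ? ?]; apply: (PQ (b, a)).
Qed.

(** A point [x] is outside [K C] exactly when [k^-1 * x] avoids [C] for every [k] in [K], and by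
    [near_compact_sub] this persists near [x]. *)
Lemma closed_mulset K C : compact K -> closed C -> closed (mulset K C).
Proof.
move=> cK cC; rewrite -openC openE => x nKCx.
have : forall k, K k -> (~` C) (k^-1 * x)%g.
  by move=> k Kk Ckx; apply: nKCx; exists k => //; exists (k^-1 * x)%g => //; rewrite mulVKg.
have hc : continuous (fun p : G * G => (p.2^-1 * p.1)%g).
  move=> p; apply: (@cvg_comp _ _ _ (fun p : G * G => (p.2^-1, p.1)%g)
    (fun p => (p.1 * p.2)%g) _ (nbhs (p.2^-1, p.1)%g)); last exact: (@mulg_continuous G (p.2^-1, p.1)%g).
  apply: cvg_pair => /=; last exact: cvg_fst.
  apply: (@cvg_comp _ _ _ snd (fun x => x^-1)%g _ (nbhs p.2)); first exact: cvg_snd.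
  exact: invg_continuous.
move=> /(near_compact_sub hc cK); rewrite openC => /(_ cC); apply: filterS => y yP [k Kk [c Cc kc]].
by apply: (yP k Kk); rewrite -kc mulKg.
Qed.

Lemma closed_rtranslate C g : closed C -> closed (rtranslate C g).
Proof.
move=> cC; rewrite (_ : rtranslate C g = (fun x => x * g^-1)%g @^-1` C).
  by apply: closed_comp => // x _; exact: continuous_mulgr.
by apply/seteqP; split => x /mem_rtranslate.
Qed.

Lemma mulset_sub_boundary K A : K 1%g -> mulset K A `<=` A `|` boundary K A.
Proof.
move=> K1 x [k Kk [a Aa kax]]; have [Ax|nAx] := pselect (A x); first by left.
right; split; first by exists k => //; exists a => //; exact: subset_closure.
by exists 1%g => //; exists x; [exact: subset_closure|rewrite mul1g].
Qed.

Lemma subset_boundary K K' A : K `<=` K' -> boundary K A `<=` boundary K' A.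
Proof.
by move=> KK' x [[k /KK' Kk [a Aa <-]] [l /KK' Kl [b Bb xE]]]; split;
  [exists k => //; exists a | exists l => //; exists b].
Qed.

Lemma boundary_rtranslate K A g :
  boundary K (rtranslate A g) `<=` rtranslate (boundary K A) g.
Proof.
have clr B : closure (rtranslate B g) `<=` rtranslate (closure B) g.
  rewrite [X in _ `<=` X](closure_id _).1; last first.
    by apply: closed_rtranslate; exact: closed_closure.
  apply: closureS => x /mem_rtranslate Bx; apply/mem_rtranslate.
  exact: subset_closure.
have rC : ~` rtranslate A g = rtranslate (~` A) g.
  apply/seteqP; split => x nAx.
    by apply/mem_rtranslate => Ax; apply/nAx/mem_rtranslate.
  by move: nAx => /mem_rtranslate nAx /mem_rtranslate.
rewrite /boundary rC.
move=> x [[k Kk [a /clr/mem_rtranslate Aa <-]] [l Kl [b /clr/mem_rtranslate Bb lb]]].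
apply/mem_rtranslate; split.
  by exists k => //; exists (a * g^-1)%g => //; rewrite mulgA.
by exists l => //; exists (b * g^-1)%g => //; rewrite mulgA lb.
Qed.

(** * Erosion, and finite unions of translates as products with the set of a sequence *)

Definition erosion F B : set G := [set c | rtranslate F c `<=` B].

(** If [c] is in [B] but [x * c] is not, for some [x] in [F], then [c = x^-1 * (x * c)] lies both in
    [K B] and in [K] times the complement of [B]. *)
Lemma sub_erosion_boundary F K B : K 1%g -> [set (x^-1)%g | x in F] `<=` K ->
  B `<=` erosion F B `|` boundary K B.
Proof.
move=> K1 FK c Bc; have [?|] := pselect (erosion F B c); first by left.
move=> /existsNP[y] /not_implyP[[x Fx <-] nBxc]; right; split.
  by exists 1%g => //; exists c; [exact: subset_closure|rewrite mul1g].
exists (x^-1)%g; first by apply: FK; exists x.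
by exists (x * c)%g; [exact: subset_closure|rewrite mulKg].
Qed.

Lemma mulset_set_cons A c s :
  mulset A [set` c :: s] = rtranslate A c `|` mulset A [set` s].
Proof.
apply/seteqP; split => [x [a Aa [b /=]]|x [[a Aa <-]|[a Aa [b /= bs <-]]]].
- rewrite inE => /orP[/eqP -> <-|bs <-]; first by left; exists a.
  by right; exists a => //; exists b.
- by exists a => //; exists c => //=; rewrite mem_head.
- by exists a => //; exists b => //=; rewrite inE bs orbT.
Qed.

Lemma mulset_set_nil A : mulset A [set` [::]] = set0.
Proof. by rewrite -subset0 => x [a _ [b]]. Qed.

Lemma compact_mulset_seq A s : compact A -> compact (mulset A [set` s]).
Proof.
move=> cA; elim: s => [|c s IHs]; first by rewrite mulset_set_nil; exact: compact0.
rewrite mulset_set_cons; apply: compactU => //; exact: compact_rtranslate.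
Qed.

Lemma mulset_seq_sub A B s :
  (forall c, c \in s -> rtranslate A c `<=` B) -> mulset A [set` s] `<=` B.
Proof. by move=> sB x [a Aa [c /= cs <-]]; apply: (sB c cs); exists a. Qed.

(** The erosion is an intersection of preimages of [B] under left translations, and it sits inside
    the compact set [F^-1 B]. *)
Lemma compact_erosion F B : F !=set0 -> closed B -> compact F -> compact B ->
  compact (erosion F B).
Proof.
move=> [x0 Fx0] clB cF cB.
apply: (@subclosed_compact _ _ (mulset [set (x^-1)%g | x in F] B)).
- rewrite (_ : erosion F B = \bigcap_(x in F) ((fun c => x * c)%g @^-1` B)).
    apply: closed_bigI => x Fx; apply: closed_comp => // c _.
    exact: continuous_mulgl.
  apply/seteqP; split => c cB' x; first by move=> Fx; apply: cB'; exists x.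
  by move=> [y Fy <-]; exact: cB'.
- by apply: compact_mulset => //; exact: compact_inv.
- move=> c cB'; exists (x0^-1)%g; first by exists x0.
  by exists (x0 * c)%g; [apply: cB'; exists x0 | rewrite mulKg].
Qed.

Hypothesis hG : hausdorff_space G.

Lemma compact_boundary K A : compact K -> compact A -> compact (boundary K A).
Proof.
move=> cK cA; have clA := compact_closed hG cA.
apply: (@subclosed_compact _ _ (mulset K A)); last 2 first.
- exact: compact_mulset.
- by apply: subIset; left; rewrite -(closure_id A).1.
by apply: closedI; apply: closed_mulset => //; exact: closed_closure.
Qed.

(** * The part of a compact set that a packing leaves uncovered *)

Section residual.
Variables (F B K : set G) (s : seq G).
Hypotheses (cF : compact F) (cB : compact B) (K1 : K 1%g).
Let U := mulset F [set` s].
(** Taking the closure makes the uncovered part compact, so that an asymptotic bound applies to it;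
    [residual_overlap] controls the overlap with [U] that this creates. *)
Let D := closure (B `\` U).

Lemma residual_sub : D `<=` B.
Proof.
rewrite [X in _ `<=` X](closure_id _).1; last exact: compact_closed.
by apply: closureS => x [].
Qed.

Lemma closure_residual c : c \in s -> D `<=` closure (~` rtranslate F c).
Proof.
move=> cs; apply: closureS => x [_ nU] [a Fa ac]; apply: nU.
by exists a => //; exists c.
Qed.

(** Such a point lies in a translate of [F] and in the closure of its complement, hence in the
    [K]-boundary of this translate because [1] is in [K]. *)
Lemma residual_overlap : D `&` U `<=` mulset (boundary K F) [set` s].
Proof.
move=> x [Dx [a Fa [c /= cs acx]]].
have /boundary_rtranslate [b bb bx] : boundary K (rtranslate F c) x.
  split; last by exists 1%g => //; exists x; [exact: closure_residual|rewrite mul1g].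
  by exists 1%g => //; exists x; [apply: subset_closure; exists a|rewrite mul1g].
by exists b => //; exists c.
Qed.

(** The complement of [D] lies in the union of the complement of [B] with the closed set [U]. A
    point of its closure is therefore in the closure of the complement of [B] or in a single
    translate of [F], which gives the two terms. *)
Lemma boundary_residual :
  boundary K D `<=` boundary K B `|` mulset (boundary K F) [set` s].
Proof.
move=> x [[k Kk [b Db kb]] [l Kl [d Dd ld]]].
have {}Db : D b by rewrite [D](closure_id _).1//; exact: closed_closure.
have : closure (~` B `|` U) d.
  apply: closureS Dd => y nDy; have [By|] := pselect (B y); last by left.
  right; apply: contrapT => nUy; apply: nDy; exact: subset_closure.
rewrite closureU => -[dB|].
  left; split; last by exists l => //; exists d.
  exists k => //; exists b => //; apply: subset_closure; exact: residual_sub.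
rewrite -(closure_id _).1; last first.
  by apply: compact_closed => //; exact: compact_mulset_seq.
move=> [a Fa [c /= cs acd]]; right.
have /boundary_rtranslate [z zF zx] : boundary K (rtranslate F c) x.
  split; last by exists k => //; exists b => //; exact: closure_residual.
  by exists l => //; exists d => //; apply: subset_closure; exists a.
by exists z => //; exists c.
Qed.

End residual.

End topology.

(** * Haar volume of compact sets *)

Section volume.
Context {R : realType} {G : topologicalGroupType}.
Variable theta : {measure set (borelType G) -> \bar R}.
Hypotheses (hG : hausdorff_space G) (theta_radon : radon theta).
Hypothesis theta_right : right_invariant theta.
Implicit Types (A B C F K O S U V : set G) (c g x y : G) (s : seq G).

Definition vol A : R := fine (theta A).

Lemma measurable_open O : open O -> measurable (O : set (borelType G)).
Proof. by move=> oO; exact: (@sub_sigma_algebra G setT open). Qed.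

Lemma measurable_closed C : closed C -> measurable (C : set (borelType G)).
Proof.
move=> cC; rewrite -[C]setCK; apply: (@measurableC _ (borelType G)).
by apply: measurable_open; rewrite openC.
Qed.

Lemma measurable_compact K : compact K -> measurable (K : set (borelType G)).
Proof. by move=> cK; apply: measurable_closed; exact: compact_closed. Qed.

Lemma theta_compact K : compact K -> theta K = (vol K)%:E.
Proof.
case: theta_radon => fin _ _ cK; rewrite fineK// ge0_fin_numE//.
exact: fin.
Qed.

Lemma theta_radon_lt K : compact K -> (theta K < +oo)%E.
Proof. by case: theta_radon => + _ _; apply. Qed.

Lemma vol_ge0 A : 0 <= vol A.
Proof. by rewrite fine_ge0. Qed.

Lemma vol_set0 : vol set0 = 0.
Proof. by rewrite /vol measure0. Qed.

Lemma vol_le A B : compact A -> compact B -> A `<=` B -> vol A <= vol B.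
Proof.
move=> cA cB AB; rewrite -lee_fin -!theta_compact//.
by apply: le_measure; rewrite ?inE//; exact: measurable_compact.
Qed.

Lemma vol_setUI A B : compact A -> compact B ->
  vol (A `|` B) + vol (A `&` B) = vol A + vol B.
Proof.
move=> cA cB; have cI : compact (A `&` B).
  by apply: compact_closedI => //; exact: compact_closed.
have [mA mB] := (measurable_compact cA, measurable_compact cB).
have := measureUfinl mA mB (theta_radon_lt cA).
rewrite !theta_compact//; last exact: compactU.
by rewrite -EFinD => -[->]; rewrite subrK.
Qed.

Lemma volU A B : compact A -> compact B -> vol (A `|` B) <= vol A + vol B.
Proof. by move=> cA cB; rewrite -vol_setUI// lerDl vol_ge0. Qed.

Lemma vol_rtranslate A g : compact A -> vol (rtranslate A g) = vol A.
Proof.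
by move=> cA; rewrite /vol theta_right//; exact: measurable_compact.
Qed.

(** * Averaging overlaps, and packing by translates *)

Lemma step_function F U V O S s (a : R) :
  compact F -> compact U -> open V -> open O ->
  measurable (S : set (borelType G)) -> (theta S < +oo)%E -> 0 <= a ->
  (forall v x, V v -> F x -> O (v * x^-1)%g) ->
  (forall c, c \in s -> (a%:E <= theta (rtranslate F c `&` U))%E) ->
  S `<=` mulset V [set` s] ->
  exists h : borelType G -> \bar R, [/\ measurable_fun setT h,
    forall y, (0 <= h y)%E, forall y, (h y <= theta (S `&` rtranslate O y))%E
    & (a%:E * theta S <= \int[theta]_(y in U) h y)%E].
Proof.
move=> cF cU oV oO + + a0 VFO.
have mU := measurable_compact cU.
elim: s S => [|c s IHs] S mS Sfin sa SV.
  exists (cst 0%E); split => // [y|]; first exact: measure_ge0.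
  have -> : S = set0 by rewrite -subset0 -[X in _ `<=` X](mulset_set_nil V).
  by rewrite measure0 mule0 integral0.
have mVc : measurable (rtranslate V c : set (borelType G)).
  by apply: measurable_open; exact: open_rtranslate.
have mFc : measurable (rtranslate F c : set (borelType G)).
  by apply: measurable_compact; exact: compact_rtranslate.
have fin T : T `<=` S -> measurable (T : set (borelType G)) -> (theta T < +oo)%E.
  by move=> TS mT; apply: le_lt_trans Sfin; apply: le_measure; rewrite ?inE.
pose S1 := S `&` rtranslate V c; pose S2 := S `\` rtranslate V c.
have mS1 : measurable (S1 : set (borelType G)) := measurableI _ _ mS mVc.
have mS2 : measurable (S2 : set (borelType G)) := measurableD mS mVc.
have S1fin : (theta S1 < +oo)%E by apply: fin => // x [].
have [||||h [mh h0 hO hint]] := IHs S2.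
- by [].
- by apply: fin => // x [].
- by move=> d ds; apply: sa; rewrite inE ds orbT.
- by move=> x [/SV]; rewrite mulset_set_cons => -[].
have S1E : theta S1 = (vol S1)%:E by rewrite /vol fineK// ge0_fin_numE.
have thetaS : theta S = (theta S2 + theta S1)%E by rewrite (measureDI theta mS mVc).
have mind : measurable_fun setT (fun y : borelType G => (\1_(rtranslate F c) y : R)%:E).
  by apply/measurable_EFinP; exact: measurable_indic.
(* In total, [h] sums the volumes of disjoint pieces of [S], each inside some [V c], times the
   indicator of [F c]. For [y] in [F c] the whole piece lies in [O y], since [V F^-1] is inside [O];
   this gives the pointwise upper bound. *)
exists (fun y => h y + (vol S1)%:E * (\1_(rtranslate F c) y)%:E)%E; split.
- apply: emeasurable_funD => //.
  by apply: emeasurable_funM => //; exact: measurable_cst.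
- by move=> y; rewrite adde_ge0// mule_ge0// lee_fin ?vol_ge0.
- move=> y; have mOy : measurable (rtranslate O y : set (borelType G)).
    by apply: measurable_open; exact: open_rtranslate.
  have mSO := measurableI _ _ mS mOy.
  rewrite (measureDI theta mSO mVc) indicE.
  rewrite -setIDA -setIDAC -/S2; apply: leeD; first exact: hO.
  have [|_] := boolP (y \in _); last by rewrite mule0.
  rewrite inE => /mem_rtranslate Fy; rewrite mule1 -S1E.
  apply: le_measure; rewrite ?inE //; first exact: (measurableI _ _ mSO mVc).
  move=> x [Sx Vx]; split=> //; split=> //; apply/mem_rtranslate.
  move/mem_rtranslate : Vx => /VFO /(_ Fy).
  by rewrite invgM invgK mulgA mulgVK.
- rewrite thetaS ge0_muleDr// ge0_integralD//=; last 3 first.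
  + exact: measurable_funTS.
  + by move=> y _; rewrite mule_ge0// lee_fin ?vol_ge0.
  + apply: measurable_funTS.
    by apply: emeasurable_funM => //; exact: measurable_cst.
  rewrite leeD// ge0_integralZl_EFin//; last 2 first.
  + exact: measurable_funTS.
  + exact: vol_ge0.
  rewrite integral_indic// S1E muleC.
  by apply: lee_wpmul2l; [rewrite lee_fin vol_ge0|exact/sa/mem_head].
Qed.


Lemma outer_regular_compact F (e : R) : compact F -> 0 < e ->
  exists2 O, open O /\ F `<=` O & (theta O <= (vol F + e)%:E)%E.
Proof.
move=> cF e0; case: theta_radon => _ outer _.
have : (theta F < (vol F + e)%:E)%E.
  by rewrite theta_compact// lte_fin ltrDl.
rewrite (outer _ (measurable_compact cF)).
move=> /ereal_inf_lt[_ [W [oW FW] <-] /ltW We].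
by exists W.
Qed.

(** Some neighbourhood [V] of [1] satisfies [V F^-1] inside [O], and finitely many [V c] cover [S].
    The resulting step function is at most [theta (O y) = theta O] by right invariance; integrate it
    over [U]. *)
Lemma overlap_average_open F U S O (a : R) :
  compact F -> compact U -> compact S -> 0 <= a ->
  open O -> [set (x^-1)%g | x in F] `<=` O ->
  (forall c, S c -> a <= vol (rtranslate F c `&` U)) ->
  (a%:E * theta S <= theta O * theta U)%E.
Proof.
move=> cF cU cS a0 oO FO Sa.
have : \forall v \near (1%g : G), forall x, F x -> O (v * x^-1)%g.
  apply: (near_compact_sub continuous_divg cF oO) => x Fx /=.
  by rewrite mul1g; apply: FO; exists x.
rewrite -[X in X -> _]/(nbhs (1%g : G) _) nbhsE => -[V [oV V1] VFO].
have cov : @cover_compact G S by rewrite -compact_cover.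
have [||D DS SD] := cov G S (rtranslate V).
- by move=> c _; exact: open_rtranslate.
- by move=> c Sc; exists c => //; exists 1%g => //; rewrite mul1g.
have SV : S `<=` mulset V [set` finmap.enum_fset D].
  by move=> x /SD[c cD [v Vv vc]]; exists v => //; exists c.
have Da c : c \in finmap.enum_fset D -> (a%:E <= theta (rtranslate F c `&` U))%E.
  move=> cD; rewrite theta_compact ?lee_fin.
    by apply: Sa; have := DS c cD; rewrite inE.
  by apply: compact_closedI; [exact: compact_rtranslate|exact: compact_closed].
have [h [mh h0 hO hint]] := step_function cF cU oV oO (measurable_compact cS)
  (theta_radon_lt cS) a0 (fun v x Vv => VFO v Vv x) Da SV.
have mU := measurable_compact cU.
apply: (le_trans hint); rewrite -integral_cst//; apply: ge0_le_integral => //.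
- exact: measurable_funTS.
- move=> y _; apply: (le_trans (hO y)).
  rewrite /cst -(theta_right y (measurable_open oO)).
  have mOy := measurable_open (open_rtranslate y oO).
  apply: le_measure; rewrite ?inE//.
  exact: measurableI (measurable_compact cS) mOy.
Qed.

(* Double counting of {(c, y) | y \in F c, y \in U}. Fubini is avoided, since
   the product of the Borel sigma-algebras can be smaller than that of G x G. *)
Lemma overlap_average F U S (a : R) :
  compact F -> compact U -> compact S -> 0 <= a ->
  (forall c, S c -> a <= vol (rtranslate F c `&` U)) ->
  a * vol S <= vol U * vol [set (x^-1)%g | x in F].
Proof.
move=> cF cU cS a0 Sa; apply/ler_addgt0Pr => e e0.
(* The [+ 1] keeps the denominator positive when [U] is null; the excess [e / (vol U + 1)] costs at
   most [e] after multiplication by [vol U]. *)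
have U1 : 0 < vol U + 1 by rewrite ltr_wpDl// vol_ge0.
have [W [oW FW] We] := outer_regular_compact (compact_inv cF) (divr_gt0 e0 U1).
have := overlap_average_open cF cU cS a0 oW FW Sa.
have /(lee_wpmul2r _) := We => /(_ (theta U) (measure_ge0 _ _)).
move=> /[swap] /le_trans/[apply].
rewrite !theta_compact// -!EFinM lee_fin => /le_trans; apply.
by rewrite mulrDl [X in X + _]mulrC lerD2l mulrAC ler_pdivrMr// ler_pM2l// lerDl.
Qed.

Lemma vol_mulset_seq A s : compact A ->
  vol (mulset A [set` s]) <= (size s)%:R * vol A.
Proof.
move=> cA; elim: s => [|c s IHs]; first by rewrite mulset_set_nil vol_set0 mul0r.
rewrite mulset_set_cons (le_trans (volU _ _))//.
- exact: compact_rtranslate.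
- exact: compact_mulset_seq.
- by rewrite vol_rtranslate//= -natr1 mulrDl mul1r addrC lerD2r.
Qed.

(** A greedy choice: while some translate inside [B] overlaps the union by less than [e * vol F],
    adding it gains at least [(1 - e) * vol F]. This must stop because [vol B] is finite. *)
Lemma packing F B (e : R) : compact F -> compact B -> e < 1 -> 0 < vol F ->
  exists s, [/\ forall c, c \in s -> rtranslate F c `<=` B,
    (1 - e) * ((size s)%:R * vol F) <= vol (mulset F [set` s])
  & forall c, rtranslate F c `<=` B ->
      e * vol F <= vol (rtranslate F c `&` mulset F [set` s])].
Proof.
move=> cF cB e1 F0; apply: contrapT => nmax.
have grow n : exists s, [/\ size s = n, forall c, c \in s -> rtranslate F c `<=` B
    & (1 - e) * (n%:R * vol F) <= vol (mulset F [set` s])].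
  elim: n => [|n [s [sn sB sF]]].
    by exists [::]; split => //; rewrite mul0r mulr0 vol_ge0.
  have : ~ forall c, rtranslate F c `<=` B ->
      e * vol F <= vol (rtranslate F c `&` mulset F [set` s]).
    by move=> smax; apply: nmax; exists s; rewrite sn.
  move=> /existsNP[c] /not_implyP[cB' /negP]; rewrite -ltNge => ce.
  exists (c :: s); split => /=; first by rewrite sn.
    by move=> d; rewrite inE => /orP[/eqP ->|/sB].
  have := vol_setUI (compact_rtranslate (g := c) cF) (compact_mulset_seq (s := s) cF).
  rewrite mulset_set_cons vol_rtranslate// -natr1 => UIE.
  nra.
have B1 : 0 <= vol B / ((1 - e) * vol F).
  by rewrite divr_ge0 ?vol_ge0// mulr_ge0 ?vol_ge0// subr_ge0 ltW.
have [s [_ sB]] := grow (Num.bound (vol B / ((1 - e) * vol F))).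
have := vol_le (compact_mulset_seq (s := s) cF) cB (mulset_seq_sub sB).
move=> /[swap] /le_trans/[apply].
rewrite mulrCA -ler_pdivlMr; last by rewrite mulr_gt0// subr_gt0.
by rewrite leNgt archi_boundP.
Qed.

(** Inner regularity on the whole group gives a compact set of positive volume, and a right
    translate of it contains [1]. *)
Lemma exists_vol_gt0 : theta [set: G] != 0%E ->
  exists V, [/\ compact V, V 1%g & 0 < vol V].
Proof.
move=> thetaT; have [K [cK K0]] : exists K, compact K /\ 0 < vol K.
  apply: contrapT => nK; move/eqP : thetaT; apply.
  case: theta_radon => _ _ /(_ setT openT) ->.
  apply/eqP; rewrite eq_le; apply/andP; split.
    apply: ub_ereal_sup => _ [K [cK _] <-]; rewrite theta_compact// lee_fin leNgt.
    by apply/negP => K0; apply: nK; exists K.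
  apply: ereal_sup_ubound; exists set0; last exact: measure0.
  by split => //; exact: compact0.
have /set0P[k Kk] : K != set0.
  by apply: contraTneq K0 => ->; rewrite vol_set0 ltxx.
exists (rtranslate K (k^-1)%g); split; first exact: compact_rtranslate.
- by exists k => //; rewrite mulgV.
- by rewrite vol_rtranslate.
Qed.

(** A Følner condition; [P] lets the almost invariant sets also carry an inequality for [f]. *)
Definition arbitrarily_invariant (P : set G -> Prop) :=
  forall K (d : R), compact K -> 0 < d ->
    exists F, [/\ compact F, 0 < vol F, vol (boundary K F) <= d * vol F & P F].

(** Apply [overlap_average] to the tile [F^-1] with window [F^-1 A] and centres [A], where [A] is
    almost invariant: every translate lies in the window, whose volume is nearly [vol A], and
    [vol A] cancels. *)
Lemma vol_inv P F : arbitrarily_invariant P -> compact F ->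
  vol [set (x^-1)%g | x in F] <= vol F.
Proof.
move=> Pinv cF; apply/ler_addgt0Pr => e e0.
have cFi := compact_inv cF; set Fi := [set _ | _ in _] in cFi *.
have F1 : 0 < vol F + 1 by rewrite ltr_wpDl// vol_ge0.
have cK : compact (1%g |` Fi) by apply: compactU => //; exact: compact_set1.
have [A [cA A0 bA _]] := Pinv _ (e / (vol F + 1)) cK (divr_gt0 e0 F1).
have cFA := compact_mulset cFi cA.
have FiA c : A c -> vol Fi <= vol (rtranslate Fi c `&` mulset Fi A).
  move=> Ac; rewrite setIidl ?vol_rtranslate// => x [y Fy <-].
  by exists y => //; exists c.
have := overlap_average cFi cFA cA (vol_ge0 _) FiA.
have -> : [set (x^-1)%g | x in Fi] = F.
  apply/seteqP; split => [_ [_ [x Fx <-] <-]|x Fx]; first by rewrite invgK.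
  by exists (x^-1)%g; [exists x|rewrite invgK].
have cb := compact_boundary hG cK cA.
have FA : vol (mulset Fi A) <= vol A + e / (vol F + 1) * vol A.
  apply: (le_trans _ (lerD (lexx _) bA)); apply: le_trans (volU _ _) => //.
  apply: vol_le => //; first exact: compactU.
  have sub : mulset Fi A `<=` mulset (1%g |` Fi) A.
    by move=> x [k Kk [a Aa <-]]; exists k; [right|exists a].
  by apply: (subset_trans sub); apply: mulset_sub_boundary; left.
have {FA} /(ler_wpM2r (vol_ge0 F)) FA :
    vol (mulset Fi A) <= (1 + e / (vol F + 1)) * vol A by rewrite mulrDl mul1r.
move=> /le_trans/(_ FA); rewrite mulrAC ler_pM2r// => /le_trans; apply.
by rewrite mulrDl mul1r lerD2l mulrAC ler_pdivrMr// ler_pM2l// lerDl.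
Qed.

(** * The set function [f] and its asymptotic bounds *)

Variable f : set G -> R.
Hypotheses (f_mono : compact_monotone f) (f_sub : compact_subadditive f).
Hypothesis f_right : compact_right_invariant f.

Lemma f_ge0 A : compact A -> 0 <= f A.
Proof.
by move=> cA; case: f_sub => <- _; apply: f_mono => //; exact: compact0.
Qed.

Lemma f_mulset_seq A s : compact A ->
  f (mulset A [set` s]) <= (size s)%:R * f A.
Proof.
move=> cA; have [f0 fU] := f_sub.
elim: s => [|c s IHs]; first by rewrite mulset_set_nil f0 mul0r.
rewrite mulset_set_cons (le_trans (fU _ _ _ _))//.
- exact: compact_rtranslate.
- exact: compact_mulset_seq.
- by rewrite f_right//= -natr1 mulrDl mul1r addrC lerD2r.
Qed.

(** Pack [V D] by translates of [V] with overlap [1/2]. By maximality each [V d] meets the packing,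
    so translates of [V^-1 V] by the same centres cover [D], and there are at most
    [2 * vol (V D) / vol V] of them. *)
Lemma f_le_vol_mulset V : compact V -> 0 < vol V ->
  exists2 C, 0 <= C & forall D, compact D -> f D <= C * vol (mulset V D).
Proof.
move=> cV V0; pose W := mulset [set (v^-1)%g | v in V] V.
have cW : compact W by apply: compact_mulset => //; exact: compact_inv.
exists (2 * f W / vol V) => [|D cD].
  by rewrite divr_ge0 ?vol_ge0// mulr_ge0// f_ge0.
have half : 2^-1 < 1 :> R by lra.
have cVD := compact_mulset cV cD.
have [s [sD sV smax]] := packing cV cVD half V0.
have DW : D `<=` mulset W [set` s].
  move=> d Dd; have /smax VVs : rtranslate V d `<=` mulset V D.
    by move=> x [v Vv <-]; exists v => //; exists d.
  have /set0P[x [[v Vv <-] [w Vw [c /= cs wc]]]] :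
      rtranslate V d `&` mulset V [set` s] != set0.
    apply: contraTneq VVs => ->; rewrite vol_set0 -ltNge.
    by rewrite mulr_gt0// invr_gt0.
  exists (v^-1 * w)%g; first by exists (v^-1)%g; [exists v|exists w].
  by exists c => //; rewrite -mulgA wc mulKg.
have fD : f D <= (size s)%:R * f W.
  by apply: le_trans (f_mulset_seq s cW); apply: f_mono => //; exact: compact_mulset_seq.
have sVD : (size s)%:R * vol V <= 2 * vol (mulset V D).
  have := vol_le (compact_mulset_seq (s := s) cV) cVD (mulset_seq_sub sD).
  lra.
apply: (le_trans fD).
have -> : 2 * f W / vol V * vol (mulset V D) = 2 * vol (mulset V D) / vol V * f W.
  by ring.
by rewrite ler_wpM2r ?f_ge0// ler_pdivlMr.
Qed.

(* The infimum of these t is the common limit along van Hove nets. *)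
Definition asymptotic_bound (t : R) : Prop := 0 <= t /\
  exists K (C : R), [/\ compact K, K 1%g, 0 <= C &
    forall B, compact B -> f B <= t * vol B + C * vol (boundary K B)].

(** As [1] is in [V], [V B] is covered by [B] and its [V]-boundary, so the constant of
    [f_le_vol_mulset] serves as both [t] and [C]. *)
Lemma asymptotic_bound_exists : theta [set: G] != 0%E ->
  exists t, asymptotic_bound t.
Proof.
move=> /exists_vol_gt0[V [cV V1 V0]].
have [C C0 fC] := f_le_vol_mulset cV V0.
exists C; split => //; exists V, C; split => // B cB.
have cb := compact_boundary hG cV cB.
apply: (le_trans (fC B cB)); rewrite -mulrDr ler_wpM2l//.
apply: le_trans (volU cB cb); apply: vol_le.
- exact: compact_mulset.
- exact: compactU.
- exact: mulset_sub_boundary.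
Qed.

Lemma arbitrarily_invariant_ge0 (L : R) :
  arbitrarily_invariant (fun F => f F <= L * vol F) -> 0 <= L.
Proof.
move=> Linv; have [F [cF F0 _ fF]] := Linv _ 1 (@compact0 G) ltr01.
by rewrite -(pmulr_lge0 _ F0) (le_trans (f_ge0 cF) fF).
Qed.

(* e is the overlap allowed when packing B with translates of a tile F that
   satisfies f F <= L * vol F. The packed part U has volume at least e * vol B
   up to a boundary term and is charged at a rate of at most (M + L) / 2; the
   bound t is applied to the rest, so t improves by g * e. *)
Lemma asymptotic_bound_step (M L t : R) :
  L < M -> M <= t -> asymptotic_bound t ->
  arbitrarily_invariant (fun F => f F <= L * vol F) ->
  asymptotic_bound (t - (M - L) ^+ 2 / (8 * M)).
Proof.
move=> LM Mt [t0 [K0 [C [cK0 K01 C0 fC]]]] Linv.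
have L0 := arbitrarily_invariant_ge0 Linv.
have M0 : 0 < M by apply: le_lt_trans LM.
(* With this [e], [2 * M * (1 - e) = M + L]. The gap between [M] and the packing rate [(M + L) / 2]
   is [2 * g]: one [g] absorbs boundary errors, the other is the gain. *)
pose g := (M - L) / 4; pose e := (M - L) / (2 * M).
have g0 : 0 < g by rewrite divr_gt0// subr_gt0.
have e0 : 0 < e by rewrite divr_gt0 ?subr_gt0// mulr_gt0.
have eM : 2 * M * e = M - L by rewrite mulrC divfK// gt_eqF// mulr_gt0.
have e1 : e < 1 by nra.
have geE : (M - L) ^+ 2 / (8 * M) = g * e.
  by rewrite /g /e; field; rewrite gt_eqF.
have tC0 : 0 < t + C by lra.
(* Makes the boundary error [(t + C) * d * N] at most [g * u], given [N <= 2 * u]. *)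
pose d := g / (2 * (t + C)).
have d0 : 0 < d by rewrite divr_gt0// mulr_gt0.
have dE : 2 * ((t + C) * d) = g.
  by rewrite /d; field; rewrite gt_eqF.
have [F [cF F0 bF fF]] := Linv K0 d cK0 d0.
have /set0P F_neq0 : F != set0.
  by apply: contraTneq F0 => ->; rewrite vol_set0 ltxx.
(* [K0] serves the old bound [t], and [F^-1] serves the erosion of [B] by [F]. *)
pose K := K0 `|` [set (x^-1)%g | x in F].
have cK : compact K by apply: compactU => //; exact: compact_inv.
have K1 : K 1%g by left.
have gE : 4 * g = M - L by rewrite /g; lra.
have geg : g * e <= g by rewrite ler_piMr ?ltW.
rewrite geE; split; first by lra.
exists K, (C + g * e); split => //; first by rewrite addr_ge0// mulr_ge0 ?ltW.
move=> B cB; have clB := compact_closed hG cB.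
have [s [sB sF smax]] := packing cF cB e1 F0.
have cU := compact_mulset_seq (s := s) cF.
have cbF := compact_boundary hG cK0 cF.
have cbs := compact_mulset_seq (s := s) cbF.
have cb0 := compact_boundary hG cK0 cB.
have cb := compact_boundary hG cK cB.
have cE := compact_erosion F_neq0 clB cF cB.
set U := mulset F [set` s] in sF smax cU.
have UB : U `<=` B by exact: mulset_seq_sub.
pose D := closure (B `\` U).
have DB : D `<=` B by exact: residual_sub.
have cD : compact D by apply: subclosed_compact DB => //; exact: closed_closure.
pose N := (size s)%:R * vol F.
have N0 : 0 <= N by rewrite mulr_ge0// vol_ge0.
(* Averaging over the centres in the erosion, each of which has overlap at least [e * vol F] by
   maximality; [vol_inv] then allows [vol F] to cancel. *)
have Eu : e * vol (erosion F B) <= vol U.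
  rewrite -(ler_pM2l F0) mulrA [vol F * e]mulrC [leRHS]mulrC.
  apply: le_trans (ler_wpM2l (vol_ge0 U) (vol_inv Linv cF)).
  apply: overlap_average => //; first by rewrite mulr_ge0 ?vol_ge0// ltW.
have BE : vol B <= vol (erosion F B) + vol (boundary K B).
  apply: le_trans (volU cE cb); apply: vol_le => //; first exact: compactU.
  by apply: sub_erosion_boundary => // x; right.
have bs : vol (mulset (boundary K0 F) [set` s]) <= d * N.
  apply: (le_trans (vol_mulset_seq s cbF)).
  by rewrite /N mulrCA ler_wpM2l.
have fB : f B <= L * N + f D.
  have [_ fU] := f_sub.
  apply: (@le_trans _ _ (f (U `|` D))).
    apply: f_mono => //; first exact: compactU.
    move=> x Bx; have [Ux|nUx] := pselect (U x); first by left.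
    by right; exact: subset_closure.
  apply: (le_trans (fU _ _ cU cD)); rewrite lerD2r.
  apply: (le_trans (f_mulset_seq s cF)).
  by rewrite /N mulrCA ler_wpM2l.
have DU : vol D + vol U <= vol B + d * N.
  rewrite -vol_setUI//; apply: lerD.
    by apply: vol_le => //; [exact: compactU|rewrite subUset].
  apply: le_trans bs; apply: vol_le => //.
    by apply: compact_closedI => //; exact: compact_closed.
  exact: residual_overlap.
have bD : vol (boundary K0 D) <= vol (boundary K B) + d * N.
  have b0 : vol (boundary K0 B) <= vol (boundary K B).
    by apply: vol_le => //; apply: subset_boundary => x; left.
  apply: le_trans (lerD b0 bs); apply: le_trans (volU cb0 cbs).
  apply: vol_le; [exact: compact_boundary|exact: compactU|exact: boundary_residual].
have fD := fC D cD.
move: sF Eu BE fB DU bD fD; rewrite -/N.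
move: (vol_ge0 U) (vol_ge0 B) (vol_ge0 D) (vol_ge0 (boundary K B)) (vol_ge0 (boundary K0 D)).
move: (vol U) (vol B) (vol D) (vol (boundary K B)) (vol (boundary K0 D)) (vol (erosion F B)) (f B) (f D).
move=> u b vd bdB bdD er fB fD u0 b0 vd0 bdB0 bdD0 sF Eu BE fBN DU bdDN fDN.
(* Since [L] is nonnegative, [e] is at most [1/2]. *)
have N2u : N <= 2 * u by nra.
(* From [(1 - e) * N <= u] the rate is [2 * M * L / (M + L)], at most [(M + L) / 2] because
   [(M - L) ^+ 2] is nonnegative. *)
have LN : L * N <= u * (M + L) / 2.
  have MN : (M + L) * N <= 2 * M * u.
    have -> : M + L = 2 * M * (1 - e) by rewrite mulrBr mulr1 eM; ring.
    by rewrite -mulrA ler_pM2l// mulr_gt0.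
  have ML0 : 0 < M + L by rewrite ltr_wpDr.
  rewrite -(ler_pM2l ML0); have := ler_wpM2l L0 MN.
  have := mulr_ge0 u0 (sqr_ge0 (M - L)); rewrite !expr2; lra.
have dN : (t + C) * (d * N) <= g * u by nra.
have h1 : t * vd <= t * (b + d * N - u) by rewrite ler_wpM2l//; lra.
have h2 : C * bdD <= C * (bdB + d * N) by rewrite ler_wpM2l.
have h3 : g * (e * (b - bdB)) <= g * u.
  rewrite ler_pM2l//; apply: le_trans Eu; rewrite ler_pM2l//; lra.
have h4 : M * u <= t * u by rewrite ler_wpM2r.
(* The packed part costs [M * u - 2 * g * u], the residual saves [t * u >= M * u], and errors return
   [g * u]. The net saving [g * u] is at least [g * e * (b - bdB)]. *)
nra.
Qed.

(** The gain in [asymptotic_bound_step] depends on [M] and [L] but not on [t], so a bound [t] within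
    that gain of the infimum [M] would be improved below [M]. *)
Lemma arbitrarily_invariant_ge (L : R) : theta [set: G] != 0%E ->
  arbitrarily_invariant (fun F => f F <= L * vol F) ->
  inf asymptotic_bound <= L.
Proof.
move=> /asymptotic_bound_exists bound_ex Linv; set M := inf _.
have bound_lb : has_lbound asymptotic_bound by exists 0 => t [].
have [LM|//] := ltP L M.
have L0 := arbitrarily_invariant_ge0 Linv.
have e0 : 0 < (M - L) ^+ 2 / (8 * M).
  by rewrite divr_gt0 ?exprn_gt0 ?subr_gt0// mulr_gt0// (le_lt_trans L0).
have [t tb tM] := inf_adherent e0 (conj bound_ex bound_lb).
have Mt : M <= t by exact: ge_inf.
have := ge_inf bound_lb (asymptotic_bound_step LM Mt tb Linv).
by rewrite -/M lerBrDr leNgt tM.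
Qed.

End volume.

(** * Convergence along van Hove nets *)

Lemma filter_tails (I : Type) (le : I -> I -> Prop) :
  directed le -> Filter (tails le).
Proof.
move=> [[i0] le_refl le_trans le_dir]; apply: filter_from_filter; first by exists i0.
move=> i j _ _; have [k [ik jk]] := le_dir i j.
by exists k => // l kl; split; [exact: le_trans ik kl|exact: le_trans jk kl].
Qed.

Theorem theorem4p8 (R : realType) (G : topologicalGroupType)
    (theta : {measure set (borelType G) -> \bar R}) (f : set G -> R) :
  hausdorff_space G -> locally_compact [set: G] ->
  amenable R G -> unimodular R G -> haar theta ->
  compact_monotone f -> compact_subadditive f -> compact_right_invariant f ->
  exists L : R,
    forall (I : Type) (le : I -> I -> Prop) (A : I -> set G),
      directed le -> van_hove theta le A ->
      f (A i) / fine (theta (A i)) @[i --> tails le] --> L.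
Proof.
move=> hG _ _ uni haar_theta f_mono f_sub f_right.
have theta_right := uni _ haar_theta.
have [theta_radon _ thetaT] := haar_theta.
have bound_ex := asymptotic_bound_exists hG theta_radon theta_right f_mono f_sub
  f_right thetaT.
have bound_inf : has_inf (asymptotic_bound theta f).
  by split=> //; exists 0 => t [].
exists (inf (asymptotic_bound theta f)) => I le A dir [cA A_gt0 A_bd].
have tailsF := filter_tails dir.
have vol_gt0 : \forall i \near tails le, 0 < vol theta (A i).
  apply: filterS A_gt0 => i.
  by rewrite (theta_compact theta_radon (cA i)) lte_fin.
apply/cvgrPdist_lt => e e0.
have e20 : 0 < e / 2 by rewrite divr_gt0.
have upper : \forall i \near tails le,
    f (A i) / fine (theta (A i)) < inf (asymptotic_bound theta f) + e.
  (* Half of [e] goes to the choice of [t]; the other half absorbs [C] times the boundary ratio,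
     eventually below [e / 2 / (C + 1)]. *)
  have [t [t0 [K [C [cK _ C0 fC]]]] tM] := inf_adherent e20 bound_inf.
  have C1 : 0 < C + 1 by rewrite ltr_wpDl.
  have /cvgrPdist_lt /(_ _ (divr_gt0 e20 C1)) := A_bd K cK.
  apply: filterS2 vol_gt0 => i vi; rewrite sub0r normrN -/(vol _ _) => bi.
  have {}bi := le_lt_trans (ler_norm _) bi.
  rewrite ltr_pdivrMr// (le_lt_trans (fC _ (cA i)))//.
  move: bi; rewrite ltr_pdivrMr// mulrAC ltr_pdivlMr// -/(vol _ _) => bi.
  have := vol_ge0 theta (boundary K (A i)); nra.
have lower : \forall i \near tails le,
    inf (asymptotic_bound theta f) - e < f (A i) / fine (theta (A i)).
  (* If the lower bound fails, it fails for indices arbitrarily far along the net. The corresponding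
     [A i] are arbitrarily invariant with [f] at most [inf - e] times the volume, against
     [arbitrarily_invariant_ge]. *)
  apply: contrapT => nlower.
  have : inf (asymptotic_bound theta f) <= inf (asymptotic_bound theta f) - e.
    apply: (arbitrarily_invariant_ge hG theta_radon theta_right) => //.
    move=> K d cK d0; apply: contrapT => nF; apply: nlower.
    have /cvgrPdist_lt /(_ _ d0) := A_bd K cK.
    apply: filterS2 vol_gt0 => i vi; rewrite sub0r normrN => bi.
    have {}bi := ltW (le_lt_trans (ler_norm _) bi).
    rewrite ltNge; apply/negP => fi; apply: nF; exists (A i); split => //.
      by rewrite -ler_pdivrMr.
    by rewrite -ler_pdivrMr.
  by rewrite lerBrDr gerDl leNgt e0.
apply: filterS2 upper lower => i ui li.
by rewrite ltr_norml; apply/andP; split; lra.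
Qed.
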